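(* Let $\lambda>0$ and let $\mathbb G$ be a finite connected transitive graph with $V$ vertices of degree $\Omega$ such that, for some constants $K_1,K_2<\infty$, $$\nabla_p(x,y)\le\delta_{x,y}+K_1\Omega^{-1}+K_2\frac{\chi^3(p)}{V}\qquad\text{for all }x,y\in\mathbb V\text{ and all }p\le p_c,$$ where $p_c=p_c(\mathbb G,\lambda)$, and such that $a:=K_1\Omega^{-1}+K_2\lambda^3<1$. Put $\epsilon_0=1/\chi(p_c)=\lambda^{-1}V^{-1/3}$, $\tilde K_2=K_2/(1-a)$, and for $\epsilon\ge0$ $$\tilde a(\epsilon)=K_1\Omega^{-1}+K_2\lambda^3\frac{\epsilon_0}{\epsilon_0+(1-a)\epsilon}.$$ Let $p=p_c-\Omega^{-1}\epsilon\in[0,1]$ with $\epsilon\ge0$. Then $$1-\epsilon_0\le\Omega p_c\le\frac{1-\epsilon_0}{1-K_1\Omega^{-1}-\tilde K_2\lambda^3\epsilon_0}$$ and $$\frac1{\epsilon_0+\epsilon}\le\chi(p)\le\frac1{\epsilon_0+[1-\tilde a(\epsilon)]\epsilon}.$$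
   Context: $\mathbb G=(\mathbb V,\mathbb B)$ is a finite connected graph with vertex set $\mathbb V$ and bond (edge) set $\mathbb B$. It is transitive: for all $x,y\in\mathbb V$ there is a graph automorphism mapping $x$ to $y$. $V=|\mathbb V|$, and $\Omega$ is the common degree of the vertices. In percolation with parameter $p\in[0,1]$ each bond is independently occupied with probability $p$ and vacant otherwise; $\mathbb P_p,\mathbb E_p$ denote probability and expectation. $x\leftrightarrow y$ means there is a path of occupied bonds from $x$ to $y$ (and $x\leftrightarrow x$ always); $\tau_p(x,y)=\mathbb P_p(x\leftrightarrow y)$; $C(x)$ is the set of vertices connected to $x$; $0\in\mathbb V$ is a fixed vertex; $\chi(p)=\mathbb E_p|C(0)|$, a strictly increasing function of $p$ with $\chi(0)=1$, $\chi(1)=V$. The triangle diagram is $\nabla_p(x,y)=\sum_{u,v\in\mathbb V}\tau_p(x,u)\tau_p(u,v)\tau_p(v,y)$, and $\delta_{x,y}$ is $1$ if $x=y$ and $0$ otherwise. For $\lambda>0$, the critical threshold $p_c=p_c(\mathbb G,\lambda)$ is the unique solution of $\chi(p_c)=\lambda V^{1/3}$; it is always assumed that $1<\lambda V^{1/3}<V$, so that $p_c$ is well defined and $0<p_c<1$.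
   Formalization: The constant K_2 is assumed nonnegative, and the upper bound on Ωp_c is claimed only when its denominator 1−K_1Ω^{-1}−K̃_2λ^3ε_0 is positive; without these the claim fails, e.g. on the graph with two vertices and one bond. *)

(* Defs.v *)
From HB Require Import structures.
From mathcomp Require Import all_boot all_order all_fingroup all_algebra.
From mathcomp Require Import classical_sets reals exp.

Set Implicit Arguments.
Unset Strict Implicit.
Unset Printing Implicit Defensive.
Import Order.TTheory GRing.Theory Num.Theory.
Local Open Scope ring_scope.

Section Graph.
Variable T : finType.

(* A bond is an unordered pair of distinct vertices, that is, a two-element
   set; the vertex set is all of T. *)
Definition bond_set (B : {set {set T}}) : Prop :=
  forall b, b \in B -> #|b| = 2%N.

Definition adj (B : {set {set T}}) : rel T := fun x y => [set x; y] \in B.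

Definition connected_graph (B : {set {set T}}) : Prop :=
  forall x y : T, connect (adj B) x y.

Definition transitive_graph (B : {set {set T}}) : Prop :=
  forall x y : T, exists f : {perm T},
    (forall u v : T, adj B (f u) (f v) = adj B u v) /\ f x = y.

Definition degree (B : {set {set T}}) (x : T) : nat :=
  #|[set b in B | x \in b]|.

(* The cluster of x when w is the set of occupied bonds. *)
Definition cluster (w : {set {set T}}) (x : T) : {set T} :=
  [set y | connect (adj w) x y].

End Graph.

Section Percolation.
Variables (R : realType) (T : finType) (B : {set {set T}}).

(* A configuration is identified with its set w \subset B of occupied bonds;
   its probability is the product of p over the occupied bonds and of 1 - p
   over the vacant ones. *)
Definition config_prob (p : R) (w : {set {set T}}) : R :=
  \prod_(b in B) (if b \in w then p else 1 - p).

Definition perc_prob (p : R) (A : pred {set {set T}}) : R :=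
  \sum_(w in powerset B | A w) config_prob p w.

Definition perc_expect (p : R) (X : {set {set T}} -> R) : R :=
  \sum_(w in powerset B) config_prob p w * X w.

Definition tau (p : R) (x y : T) : R :=
  perc_prob p (fun w => connect (adj w) x y).

Definition triangle (p : R) (x y : T) : R :=
  \sum_(u : T) \sum_(v : T) tau p x u * tau p u v * tau p v y.

Definition chi (o : T) (p : R) : R :=
  perc_expect p (fun w => #|cluster w o|%:R).

(* The solution in [0, 1] of chi p = lambda * V^(1/3); the default 0 is
   irrelevant when 1 < lambda * V^(1/3) < V on a connected graph, where the
   solution exists and is unique. *)
Definition p_crit (o : T) (lambda : R) : R :=
  xget 0 [set p : R | 0 <= p <= 1 /\
                      chi o p = lambda * #|T|%:R `^ (3%:R^-1)]%classic.

End Percolation.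

(* Main.v *)
From mathcomp Require Import boolp functions topology normedtype derive realfun.
Require Import Defs.
From HB Require Import structures.
From mathcomp Require Import all_boot all_order all_fingroup all_algebra.
From mathcomp Require Import classical_sets reals exp.
From mathcomp Require Import ring lra.
From mathcomp Require Import finset.

(** Write [chi] for the expected cluster size and [M] for a bound on the
    triangle diagram at the two ends of a bond.  The theorem results from
    integrating the differential inequalities of Aizenman and Newman
        [(1 - M) Omega chi^2 <= chi' <= Omega chi^2],
    that is [(1 - M) Omega <= - (1 / chi)' <= Omega] ([dchi_upper] and
    [dchi_lower]).

    By Russo's formula, [chi'] counts the pairs of a vertex [x] and an oriented
    bond [uv] that is pivotal for the connection from [o] to [x] and is crossed
    from [u] to [v].  Pivotality requires disjoint connections from [o] to [u]
    and from [v] to [x], so the van den Berg-Kesten inequality bounds its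
    probability by [tau o u * tau v x]; the sum of this over [x] and [uv] is
    [Omega chi^2].  For the lower bound, condition on the cluster of [o]: the
    connection from [v] to [x] must avoid it, and the error made by ignoring
    this constraint is at most the sum over [z] of
    [P (o <-> u, o <-> z) * tau v z * tau z x].  The tree-graph inequality
    bounds the first factor by the sum over [y] of
    [tau o y * tau y u * tau y z].  The factors [tau y u * tau y z * tau v z]
    then form a triangle diagram between [u] and [v] that passes through [y].
    Its sum over [u], [v] and [z] does not depend on [y] by transitivity, so it
    equals its average over [y], which is at most [Omega M].

    The upper bound on [chi'] alone gives [1 / chi p <= eps0 + eps].  For the
    lower bound on [1 / chi p], monotonicity of [chi] and the definition of
    [pc] give [M <= a] below [pc], hence a first estimate
    [eps0 + (1 - a) eps <= 1 / chi p].  This is inserted back in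
    [M = K1 / Omega + K2 lambda^3 (eps0 chi)^3], and a second integration
    produces [atilde] ([inv_chi_ge_improved]).  Finally [p = 0], where
    [chi = 1], yields the bounds on [Omega pc]. *)

Set Implicit Arguments.
Unset Strict Implicit.
Unset Printing Implicit Defensive.
Import Order.TTheory GRing.Theory Num.Theory numFieldNormedType.Exports.
Local Open Scope ring_scope.

(** * Expectation of a function of the occupied bonds *)

Lemma finset_ind (I : finType) (P : {set I} -> Prop) :
  P set0 -> (forall x (A : {set I}), x \notin A -> P A -> P (x |: A)) ->
  forall A, P A.
Proof.
move=> P0 PS A; have [n] := ubnP #|A|; elim: n A => // n IH A.
have [->//|/set0Pn[x xA]] := eqVneq A set0.
rewrite (cardsD1 x) xA ltnS => lt_n; rewrite -(setD1K xA).
by apply: PS; [rewrite setD11 | exact: IH].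
Qed.

Section Expectation.
Variables (R : realType) (T : finType).
Implicit Types (p : R) (B w : {set {set T}}) (b : {set T}).
Implicit Types (X Y : {set {set T}} -> R).

(** Conditioning on the status of one bond; this is the step of the inductions
    on [B] below. *)
Lemma perc_expect_setU1 B b p X : b \notin B ->
  perc_expect (b |: B) p X =
  (1 - p) * perc_expect B p X + p * perc_expect B p (fun w => X (b |: w)).
Proof.
move=> bB; rewrite /perc_expect (bigID (fun w => b \in w)) /= addrC.
congr (_ + _); rewrite mulr_sumr.
  apply: eq_big => [w|w].
    rewrite !powersetE; apply/andP/idP => [[wB bw]|wB].
      apply/fintype.subsetP => c cw; have := fintype.subsetP wB c cw.
      by rewrite in_setU1; case: eqP => // cb; rewrite -cb cw in bw.
    split; first by apply: fintype.subset_trans wB (subsetU1 _ _).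
    by apply: contra bB; apply: fintype.subsetP.
  case/andP => _ bw; rewrite /config_prob big_setU1 //= (negPf bw).
  by rewrite -mulrA.
rewrite (reindex_onto (fun w => b |: w) (fun w => w :\ b)) /=; last first.
  by move=> w /andP[_ bw]; rewrite setD1K.
apply: eq_big => [w|w].
  rewrite !powersetE setU11 andbT; apply/andP/idP => [[wB /eqP bw]|wB].
    rewrite -bw; apply/fintype.subsetP => c; rewrite in_setD1 => /andP[cb cw].
    by have := fintype.subsetP wB c cw; rewrite in_setU1 (negPf cb).
  split; first by apply: setUS.
  apply/eqP; apply: setU1K; apply: contra bB; exact: fintype.subsetP.
rewrite powersetE => /andP[/andP[_ _] /eqP bw].
rewrite /config_prob big_setU1 //= setU11 -mulrA; congr (_ * (_ * _)).
apply: eq_bigr => c cB; rewrite in_setU1.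
by case: eqP => // cb; rewrite cb (negPf bB) in cB.
Qed.

Lemma perc_expect_set0 p X : perc_expect set0 p X = X set0.
Proof.
rewrite /perc_expect powerset0 big_set1 /config_prob big_set0.
exact: mul1r.
Qed.

Lemma eq_perc_expect B p X Y :
  (forall w, w \subset B -> X w = Y w) -> perc_expect B p X = perc_expect B p Y.
Proof. by move=> XY; apply: eq_bigr => w; rewrite powersetE => /XY->. Qed.

Lemma perc_expect_sum (I : Type) (r : seq I) (P : pred I) B p
    (F : I -> {set {set T}} -> R) :
  perc_expect B p (fun w => \sum_(i <- r | P i) F i w) =
  \sum_(i <- r | P i) perc_expect B p (F i).
Proof.
rewrite /perc_expect exchange_big /=; apply: eq_bigr => w _.
by rewrite mulr_sumr.
Qed.

Lemma perc_expectD B p X Y :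
  perc_expect B p (fun w => X w + Y w) = perc_expect B p X + perc_expect B p Y.
Proof. by rewrite -big_split; apply: eq_bigr => w _; rewrite mulrDr. Qed.

Lemma perc_expectZ B p (c : R) X :
  perc_expect B p (fun w => c * X w) = c * perc_expect B p X.
Proof. by rewrite [RHS]mulr_sumr; apply: eq_bigr => w _; rewrite mulrCA. Qed.

Lemma perc_expectB B p X Y :
  perc_expect B p (fun w => X w - Y w) = perc_expect B p X - perc_expect B p Y.
Proof. by rewrite -sumrB; apply: eq_bigr => w _; rewrite mulrBr. Qed.

Lemma config_prob_ge0 B p w : 0 <= p <= 1 -> 0 <= config_prob B p w.
Proof.
case/andP=> p0 p1; apply: prodr_ge0 => b _.
by case: ifP; rewrite ?subr_ge0.
Qed.

Lemma le_perc_expect B p X Y : 0 <= p <= 1 ->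
  (forall w, w \subset B -> X w <= Y w) ->
  perc_expect B p X <= perc_expect B p Y.
Proof.
move=> p01 XY; apply: ler_sum => w; rewrite powersetE => /XY.
exact/ler_wpM2l/config_prob_ge0.
Qed.

Lemma perc_expect_cst B p (c : R) : perc_expect B p (fun=> c) = c.
Proof.
elim/finset_ind: B => [|b B bB IH]; first by rewrite perc_expect_set0.
by rewrite perc_expect_setU1 // IH; ring.
Qed.

Lemma perc_expect_p0 B X : perc_expect B 0 X = X set0.
Proof.
elim/finset_ind: B => [|b B bB IH]; first by rewrite perc_expect_set0.
by rewrite perc_expect_setU1 // IH; ring.
Qed.

Lemma perc_expect_p1 B X : perc_expect B 1 X = X B.
Proof.
elim/finset_ind: B X => [|b B bB IH] X; first by rewrite perc_expect_set0.
by rewrite perc_expect_setU1 // !IH; ring.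
Qed.

Lemma perc_prob_expect B p (A : pred {set {set T}}) :
  perc_prob B p A = perc_expect B p (fun w => (A w)%:R).
Proof.
rewrite /perc_prob /perc_expect big_mkcondr; apply: eq_bigr => w _.
by case: (A w); rewrite ?mulr1 ?mulr0.
Qed.

Lemma le_perc_prob B p (A C : pred {set {set T}}) : 0 <= p <= 1 ->
  (forall w, w \subset B -> A w -> C w) -> perc_prob B p A <= perc_prob B p C.
Proof.
move=> p01 AC; rewrite !perc_prob_expect; apply: le_perc_expect => // w wB.
by case: (A w) (AC w wB) => [->//|_]; rewrite ler0n.
Qed.

Lemma perc_prob_ge0 B p (A : pred {set {set T}}) :
  0 <= p <= 1 -> 0 <= perc_prob B p A.
Proof. by move=> p01; apply: sumr_ge0 => w _; apply: config_prob_ge0. Qed.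

(** Quantities that live on complementary sets of bonds are independent: the
    bond added in each step of the induction is seen by only one of them. *)
Lemma perc_expect_indep B D p X Y :
  (forall w, X w = X (w :&: D)) -> (forall w, Y w = Y (w :\: D)) ->
  perc_expect B p (fun w => X w * Y w) = perc_expect B p X * perc_expect B p Y.
Proof.
elim/finset_ind: B X Y => [|b B bB IH] X Y XD YD.
  by rewrite !perc_expect_set0.
rewrite !perc_expect_setU1 // !IH //; last first.
- by move=> w; rewrite YD setDUl [in RHS]YD setDUl setDDl setUid.
- by move=> w; rewrite XD setIUl [in RHS]XD setIUl -setIA setIid.
have [bD|bD] := boolP (b \in D).
  have -> : perc_expect B p (fun w => Y (b |: w)) = perc_expect B p Y.
    apply: eq_perc_expect => w _; rewrite YD [RHS]YD setDUl.
    suff -> : [set b] :\: D = set0 by rewrite set0U.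
    by apply/eqP; rewrite setD_eq0 sub1set.
  by ring.
have -> : perc_expect B p (fun w => X (b |: w)) = perc_expect B p X.
  apply: eq_perc_expect => w _; rewrite XD [RHS]XD setIUl.
  suff -> : [set b] :&: D = set0 by rewrite set0U.
  by apply/eqP; rewrite setI_eq0 disjoints1.
by ring.
Qed.

End Expectation.

(** * The van den Berg-Kesten inequality *)

Section BK.
Variables (R : realType) (T : finType).
Implicit Types (p : R) (B w S : {set {set T}}) (b : {set T}).
Implicit Types (A C : pred {set {set T}}).

Definition increasing A :=
  forall w w' : {set {set T}}, w \subset w' -> A w -> A w'.

(** Disjoint occurrence of two increasing events: splitting [w] in two parts
    is the same as finding disjoint witnesses inside [w]. *)
Definition disj_occur A C : pred {set {set T}} :=
  fun w => [exists S : {set {set T}}, A (w :&: S) && C (w :\: S)].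

Lemma disj_occur_increasing A C :
  increasing A -> increasing C -> increasing (disj_occur A C).
Proof.
move=> iA iC w w' ww' /existsP[S /andP[Aw Cw]]; apply/existsP; exists S.
by rewrite (iA _ _ _ Aw) ?(iC _ _ _ Cw) ?setSI ?setSD.
Qed.

Lemma increasing_setU1 A b : increasing A -> increasing (fun w => A (b |: w)).
Proof. by move=> iA w w' ww'; apply: iA; apply: setUS. Qed.

Lemma disj_occurS A C A' C' w :
  (forall w, A w -> A' w) -> (forall w, C w -> C' w) ->
  disj_occur A C w -> disj_occur A' C' w.
Proof.
move=> AA' CC' /existsP[S /andP[/AA' Aw /CC' Cw]].
by apply/existsP; exists S; rewrite Aw Cw.
Qed.

(** A bond serves at most one of two disjoint witnesses. *)
Lemma disj_occur_setU1 A C b w : disj_occur A C (b |: w) ->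
  disj_occur (fun w => A (b |: w)) C w || disj_occur A (fun w => C (b |: w)) w.
Proof.
case/existsP => S /andP[Aw Cw]; apply/orP; have [bS|bS] := boolP (b \in S).
  left; apply/existsP; exists S; apply/andP; split.
    suff -> : b |: w :&: S = (b |: w) :&: S by [].
    by rewrite setIUl; congr (_ :|: _); apply/esym/setIidPl; rewrite sub1set.
  suff <- : (b |: w) :\: S = w :\: S by [].
  by rewrite setDUl; apply/setUidPr; rewrite subDset sub1set inE bS.
right; apply/existsP; exists S; apply/andP; split.
  suff <- : (b |: w) :&: S = w :&: S by [].
  by rewrite setIUl; apply/setUidPr; apply/fintype.subsetP => c;
    rewrite !inE => /andP[/eqP-> /idPn]; rewrite bS.
suff -> : b |: w :\: S = (b |: w) :\: S by [].
rewrite setDUl; congr (_ :|: _); apply/esym/setDidPl.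
by rewrite disjoints1.
Qed.

(** Induction on the set of bonds.  With [b] vacant or occupied an event [A]
    becomes one of [A0 \subset A1]; the event [A] disjoint from [C] becomes
    [A0 o C0], resp. [A1 o C0 \/ A0 o C1].  Both events of this disjunction
    contain [A0 o C0], which gives
    [P <= P (A1 o C0) + P (A0 o C1) - P (A0 o C0)], and are contained in
    [A1 o C1].  The first bound suffices if [p <= 1/2]; for larger [p] it is
    averaged with the second one so that the terms [P (A0 o C0)] cancel. *)
Lemma BK_inequality B p A C : 0 <= p <= 1 -> increasing A -> increasing C ->
  perc_prob B p (disj_occur A C) <= perc_prob B p A * perc_prob B p C.
Proof.
move=> p01; elim/finset_ind: B A C => [|b B bB IH] A C iA iC.
  rewrite !perc_prob_expect !perc_expect_set0 -natrM ler_nat mulnb.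
  case: (boolP (disj_occur A C _)) => // /existsP[S].
  by rewrite set0I set0D => ->.
pose A1 w := A (b |: w); pose C1 w := C (b |: w).
have iA1 : increasing A1 by apply: increasing_setU1.
have iC1 : increasing C1 by apply: increasing_setU1.
have AA1 w : A w -> A1 w by apply: iA; apply: subsetU1.
have CC1 w : C w -> C1 w by apply: iC; apply: subsetU1.
have split D : perc_prob (b |: B) p D =
    (1 - p) * perc_prob B p D + p * perc_prob B p (fun w => D (b |: w)).
  by rewrite !perc_prob_expect perc_expect_setU1.
rewrite !split -/A1 -/C1.
set U := perc_prob B p (fun w => disj_occur A C (b |: w)).
have := IH _ _ iA iC; have := IH _ _ iA1 iC.
have := IH _ _ iA iC1; have := IH _ _ iA1 iC1.
have : perc_prob B p A <= perc_prob B p A1 by apply: le_perc_prob => // w _ /AA1.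
have : perc_prob B p C <= perc_prob B p C1 by apply: le_perc_prob => // w _ /CC1.
have : U <= perc_prob B p (disj_occur A1 C1).
  apply: le_perc_prob => // w _ /disj_occur_setU1 /orP[];
  exact: disj_occurS.
have : U + perc_prob B p (disj_occur A C) <=
       perc_prob B p (disj_occur A1 C) + perc_prob B p (disj_occur A C1).
  rewrite /U !perc_prob_expect -!perc_expectD; apply: le_perc_expect => // w _.
  have := @disj_occur_setU1 A C b w.
  have := @disj_occurS A C A1 C w AA1 (fun _ => id).
  have := @disj_occurS A C A C1 w (fun _ => id) CC1.
  rewrite -/A1 -/C1 -!natrD ler_nat.
  (do 4!case: (disj_occur _ _ _)) => //= h1 h2 h3;
    by [have := h1 isT | have := h2 isT | have := h3 isT].
have := perc_prob_ge0 B (disj_occur A C) p01.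
case/andP: p01 => p0 p1.
move: (perc_prob B p (disj_occur A C)) => P00.
move: (perc_prob B p (disj_occur A C1)) => P01.
move: (perc_prob B p (disj_occur A1 C)) => P10.
move: (perc_prob B p (disj_occur A1 C1)) => P11.
move: (perc_prob B p A) (perc_prob B p A1) => a0 a1.
move: (perc_prob B p C) (perc_prob B p C1) U => c0 c1 U.
move=> h00 hU1 hU2 c01 a01 h4 h3 h2 h1.
have ac : 0 <= (a1 - a0) * (c1 - c0) by rewrite mulr_ge0 // subr_ge0.
have [p12|p12] := lerP p (1 - p).
  have e1 : p * (U + P00) <= p * (P10 + P01) by rewrite ler_wpM2l.
  have e2 : (1 - 2 * p) * P00 <= (1 - 2 * p) * (a0 * c0).
    by rewrite ler_wpM2l //; lra.
  have e3 : p * (P10 + P01) <= p * (a1 * c0 + a0 * c1).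
    by rewrite ler_wpM2l //; lra.
  have e4 : 0 <= p ^+ 2 * ((a1 - a0) * (c1 - c0)) by rewrite mulr_ge0 ?sqr_ge0.
  by nra.
have e1 : (1 - p) * (U + P00) <= (1 - p) * (a1 * c0 + a0 * c1).
  by rewrite ler_wpM2l //; lra.
have e2 : (2 * p - 1) * U <= (2 * p - 1) * (a1 * c1).
  by rewrite ler_wpM2l //; lra.
have e4 : 0 <= (1 - p) ^+ 2 * ((a1 - a0) * (c1 - c0)).
  by rewrite mulr_ge0 ?sqr_ge0.
by nra.
Qed.

End BK.

(** * Russo's formula *)

Section Russo.
Variables (R : realType) (T : finType).
Implicit Types (p : R) (B w : {set {set T}}) (b : {set T}).

Lemma perc_expect_deriv B (X : {set {set T}} -> R) p :
  is_derive p 1 (fun p => perc_expect B p X)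
    (\sum_(b in B) perc_expect B p (fun w => X (b |: w) - X (w :\ b))).
Proof.
elim/finset_ind: B X => [|b B bB IH] X.
  have -> : (fun p => perc_expect set0 p X) = cst (X set0).
    by apply: funext => q; rewrite perc_expect_set0.
  by rewrite big_set0; apply: is_derive_cst.
pose Xb w := X (b |: w).
have -> : (fun p => perc_expect (b |: B) p X) =
    ((cst 1 - id) * (fun p => perc_expect B p X) +
     id * (fun p => perc_expect B p Xb)).
  by apply: funext => q; rewrite perc_expect_setU1.
apply: is_derive_eq; rewrite big_setU1 //= !perc_expect_setU1 //.
have bw w : w \subset B -> b \notin w.
  by move=> wB; apply: contra bB; apply: fintype.subsetP.
have -> : perc_expect B p (fun w => X (b |: w) - X (w :\ b)) =
    perc_expect B p Xb - perc_expect B p X.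
  rewrite -perc_expectB; apply: eq_perc_expect => w /bw nbw.
  by congr (_ - X _); apply/setDidPl; rewrite disjoint_sym disjoints1.
have -> : perc_expect B p (fun w => X (b |: (b |: w)) - X ((b |: w) :\ b)) =
    perc_expect B p Xb - perc_expect B p X.
  rewrite -perc_expectB; apply: eq_perc_expect => w /bw nbw.
  by rewrite /Xb setUA setUid setU1K.
rewrite [X in _ = _ + X](eq_bigr (fun c =>
  (1 - p) * perc_expect B p (fun w => X (c |: w) - X (w :\ c)) +
  p * perc_expect B p (fun w => Xb (c |: w) - Xb (w :\ c)))); last first.
  move=> c cB; rewrite perc_expect_setU1 //; congr (_ + _ * _).
  apply: eq_perc_expect => w _; rewrite /Xb setUCA; congr (_ - X _).
  rewrite setDUl; congr (_ :|: _); apply/setDidPl; rewrite disjoints1 inE.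
  by apply: contraNneq bB => ->.
rewrite big_split /= -!mulr_sumr /GRing.scale /=.
have -> : (cst 1 - id) p = 1 - p by [].
by ring.

Qed.

End Russo.

(** * Connections and clusters *)

Section Connections.
Variable T : finType.
Implicit Types (w S D : {set {set T}}) (A U : {set T}) (x y z u v : T).

Lemma adj_sym w : symmetric (adj w).
Proof. by move=> x y; rewrite /adj setUC. Qed.

Lemma connect_adjC w x y : connect (adj w) x y = connect (adj w) y x.
Proof. exact/sym_connect_sym/adj_sym. Qed.

Lemma connect_adjS w w' x y :
  w \subset w' -> connect (adj w) x y -> connect (adj w') x y.
Proof.
move=> ww'; apply: connect_sub => a b ab; apply: connect1.
exact: fintype.subsetP ww' _ ab.
Qed.

Lemma connect_ind (e : rel T) (P : T -> Prop) x y :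
  P x -> (forall a b, connect e x a -> P a -> e a b -> P b) ->
  connect e x y -> P y.
Proof.
move=> Px Pe /connectP[p]; elim/last_ind: p y => [|p z IH] y /=.
  by move=> _ ->.
rewrite rcons_path last_rcons => /andP[ep ez] ->.
by apply: Pe ez; [apply/connectP; exists p | apply: IH].
Qed.

Definition inner_bonds w U := [set b in w | b \subset U].

Lemma inner_bonds_sub w U : inner_bonds w U \subset w.
Proof. by apply/fintype.subsetP => b; rewrite inE => /andP[]. Qed.

Lemma path_connect_inner w U x p : path (adj w) x p ->
  {subset x :: p <= U} -> connect (adj (inner_bonds w U)) x (last x p).
Proof.
elim: p x => [|y p IH] x /=; first by rewrite connect0.
case/andP=> xy yp xpU; apply: (connect_trans (y := y)); last first.
  by apply: IH yp _ => z zp; apply: xpU; rewrite inE zp orbT.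
apply: connect1; rewrite /adj inE; apply/andP; split=> //.
apply/fintype.subsetP => z.
by rewrite !inE => /orP[] /eqP->; apply: xpU; rewrite !inE eqxx ?orbT.
Qed.

(** Bonds have two ends, so connections inside two vertex sets that share one
    vertex use different bonds. *)
Lemma inner_bonds_disjoint w U U' z : bond_set w -> U :&: U' \subset [set z] ->
  inner_bonds w U' \subset w :\: inner_bonds w U.
Proof.
move=> w2 UU'; apply/fintype.subsetP => b; rewrite !inE => /andP[bw bU'].
rewrite bw andbT /=; apply/negP => bU.
have : (#|b| <= #|[set z]|)%N.
  by apply/subset_leq_card/(fintype.subset_trans _ UU'); rewrite subsetI bU.
by rewrite cards1 w2.
Qed.

Definition conn x y : pred {set {set T}} := fun w => connect (adj w) x y.

Lemma conn_increasing x y : increasing (conn x y).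
Proof. by move=> w w' ww'; apply: connect_adjS. Qed.

Lemma disj_occur_inner w U U' z (P P' : pred {set {set T}}) : bond_set w ->
  U :&: U' \subset [set z] -> increasing P' ->
  P (inner_bonds w U) -> P' (inner_bonds w U') -> disj_occur P P' w.
Proof.
move=> w2 UU' iP' PU PU'; apply/existsP; exists (inner_bonds w U).
rewrite (setIidPr (inner_bonds_sub w U)) PU /=.
exact: iP' (inner_bonds_disjoint w2 UU') PU'.
Qed.

(** Self-avoidance of the path makes [z] the only vertex that its parts before
    and after [z] have in common. *)
Lemma conn_split w x p z : bond_set w -> path (adj w) x p -> uniq (x :: p) ->
  z \in x :: p ->
  exists2 UU : {set T} * {set T}, UU.1 :&: UU.2 \subset [set z] &
    [/\ UU.1 :|: UU.2 \subset [set t in x :: p],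
     conn x z (inner_bonds w UU.1) & conn z (last x p) (inner_bonds w UU.2)].
Proof.
move=> w2 xp up zp; case/splitPl: p / zp xp up => p1 p2 Ez xp up.
rewrite cat_path in xp; case/andP: xp => xp1; rewrite Ez => xp2.
rewrite -cat_cons cat_uniq in up; case/and3P: up => u1 u12 u2.
exists ([set t in x :: p1], [set t in z :: p2]) => /=.
  apply/fintype.subsetP => t; rewrite !inE.
  case/andP => t1 /orP[//|t2]; case/hasP: u12.
  by exists t.
split.
- apply/fintype.subsetP => t; rewrite !inE mem_cat -Ez.
  have := mem_last x p1; rewrite inE -orbA => lp.
  by case/or4P => [->|->|/eqP->|->]; rewrite ?orbT // orbA lp.
- by rewrite -Ez; apply: path_connect_inner xp1 _ => t; rewrite in_set.
by rewrite last_cat Ez; apply: path_connect_inner xp2 _ => t; rewrite in_set.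
Qed.

(** The conjunct [x \notin A] matters when [x = y]: the empty path at a vertex
    of [A] does not avoid [A]. *)
Definition conn_off A x y : pred {set {set T}} :=
  fun w => (x \notin A) && connect (adj (inner_bonds w (~: A))) x y.

(** A self-avoiding path that meets [A] is cut at a meeting point. *)
Lemma conn_through A x y w : bond_set w -> conn x y w -> ~~ conn_off A x y w ->
  exists2 z, z \in A & disj_occur (conn x z) (conn z y) w.
Proof.
move=> w2 /connectP[p0 xp0 ->]; case/shortenP: xp0 => p xp up _ off.
have [/hasP[z zp zA]|/hasPn noA] := boolP (has [in A] (x :: p)).
  have [[U U'] /= UU' [_ cU cU']] := conn_split w2 xp up zp.
  exists z => //; apply: disj_occur_inner UU' _ cU cU' => //.
  exact: conn_increasing.
case/negP: off; rewrite /conn_off noA ?mem_head //=.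
by apply: path_connect_inner xp _ => t tp; rewrite in_setC; apply: noA.
Qed.

Lemma path_enter (e : rel T) (a : pred T) x p :
  path e x p -> ~~ a x -> a (last x p) ->
  exists q z,
    [/\ path e x q, {in x :: q, forall t, ~~ a t}, e (last x q) z & a z].
Proof.
elim: p x => [|y p IH] x /=; first by move=> _ /negPf->.
case/andP=> xy yp nax ap; have [ay|nay] := boolP (a y).
  by exists [::], y; split=> // t; rewrite inE => /eqP->.
have [q [z [yq nq qz az]]] := IH _ yp nay ap; exists (y :: q), z.
split=> //=; first by rewrite xy.
by move=> t; rewrite inE => /orP[/eqP->|/nq].
Qed.

Lemma path_first_hit (e : rel T) (a : pred T) x p :
  path e x p -> a (last x p) ->
  exists2 q, path e x q &
    a (last x q) /\ forall t, t \in x :: q -> a t -> t = last x q.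
Proof.
move=> xp ap; have [ax|nax] := boolP (a x).
  by exists [::] => //; split=> // t; rewrite inE => /eqP.
have [q [z [xq nq qz az]]] := path_enter xp nax ap.
exists (rcons q z); first by rewrite rcons_path xq.
rewrite last_rcons; split=> // t; rewrite -rcons_cons mem_rcons inE.
by case/orP => [/eqP//|/nq/negPf->].
Qed.

(** The tree-graph property: follow a path from [u] to [x] up to the point [z]
    where it first meets a self-avoiding path from [x] to [y]. *)
Lemma conn_tree w x y u : bond_set w -> conn x y w -> conn x u w ->
  exists z, disj_occur (conn x z) (disj_occur (conn z u) (conn z y)) w.
Proof.
move=> w2 /connectP[p0 xp0 ->]; case/shortenP: xp0 => p xp up _.
rewrite /conn connect_adjC => /connectP[q0 uq0 xq0].
have [|q uq [zp first_hit]] := path_first_hit (a := [in x :: p]) uq0.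
  by rewrite -xq0 /= mem_head.
set z := last u q in zp first_hit.
have [[U U'] /= UU' [Usub cU cU']] := conn_split w2 xp up zp.
pose Q := [set t in u :: q].
have cQ : conn z u (inner_bonds w Q).
  rewrite /conn connect_adjC; apply: path_connect_inner uq _ => t.
  by rewrite in_set.
have QU : Q :&: (U :|: U') \subset [set z].
  apply/fintype.subsetP => t; rewrite in_setI 2!inE => /andP[tq tU].
  apply/eqP/first_hit => //=.
  by have := fintype.subsetP Usub t tU; rewrite inE.
have UQ : U :&: Q \subset [set z].
  by rewrite setIC; apply: fintype.subset_trans QU; apply: setIS; apply: subsetUl.
have QU' : Q :&: U' \subset [set z].
  by apply: fintype.subset_trans QU; apply: setIS; apply: subsetUr.
have sQ := inner_bonds_disjoint w2 UQ; have sU' := inner_bonds_disjoint w2 UU'.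
have sQU' := inner_bonds_disjoint w2 QU'.
exists z; apply/existsP; exists (inner_bonds w U); apply/andP; split.
  by rewrite (setIidPr (inner_bonds_sub w U)).
apply/existsP; exists (inner_bonds w Q); apply/andP; split.
  by rewrite (setIidPr sQ).
apply: conn_increasing cU'; rewrite subsetD; move: sQU'.
by rewrite subsetD => /andP[_ ->]; rewrite sU'.

Qed.

End Connections.

(** * Correlation inequalities *)

Section Correlations.
Variables (R : realType) (T : finType) (B : {set {set T}}) (p : R).
Hypotheses (hB : bond_set B) (p01 : 0 <= p <= 1).
Implicit Types (A : {set T}) (o x y z u v : T) (w : {set {set T}}).

Let bond_sub w : w \subset B -> bond_set w.
Proof. by move=> wB b bw; apply/hB/(fintype.subsetP wB). Qed.

Lemma perc_prob_le_sum (P : pred T) (F : pred {set {set T}})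
    (G : T -> pred {set {set T}}) :
  (forall w, w \subset B -> F w -> exists2 z, P z & G z w) ->
  perc_prob B p F <= \sum_(z | P z) perc_prob B p (G z).
Proof.
move=> FG; under eq_bigr do rewrite perc_prob_expect.
rewrite -perc_expect_sum perc_prob_expect; apply: le_perc_expect => // w wB.
have [/(FG w wB)[z Pz Gz]|_] := boolP (F w); last by apply: sumr_ge0.
by rewrite (bigD1 z) //= Gz lerDl sumr_ge0.
Qed.

Lemma tau_ge0 x y : 0 <= tau B p x y.
Proof. exact: perc_prob_ge0. Qed.

Lemma tauC x y : tau B p x y = tau B p y x.
Proof.
rewrite /tau !perc_prob_expect; apply: eq_perc_expect => w _.
by rewrite connect_adjC.
Qed.

Lemma tree_graph_inequality x y u :
  perc_prob B p (fun w => conn x y w && conn x u w) <=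
  \sum_z tau B p x z * (tau B p z u * tau B p z y).
Proof.
have disj z : perc_prob B p
    (disj_occur (conn x z) (disj_occur (conn z u) (conn z y))) <=
    tau B p x z * (tau B p z u * tau B p z y).
  apply: le_trans (BK_inequality B p01 _ _) _; first exact: conn_increasing.
    by apply: disj_occur_increasing; apply: conn_increasing.
  apply: ler_wpM2l; first exact: tau_ge0.
  by apply: BK_inequality => //; apply: conn_increasing.
apply: le_trans (ler_sum _ (fun z _ => disj z)).
apply: perc_prob_le_sum => w /bond_sub w2 /andP[xy xu].
by have [z] := conn_tree w2 xy xu; exists z.
Qed.

(** By [conn_through] and the van den Berg-Kesten inequality, the sum bounds
    the probability of a connection that fails to avoid [A].  If [x] lies in
    [A], the term [z = x] alone makes the left side nonpositive. *)
Lemma tau_off_ge A x y :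
  tau B p x y - \sum_(z in A) tau B p x z * tau B p z y <=
  perc_prob B p (conn_off A x y).
Proof.
have disj z : perc_prob B p (disj_occur (conn x z) (conn z y)) <=
    tau B p x z * tau B p z y.
  by apply: BK_inequality => //; apply: conn_increasing.
rewrite lerBlDr -lerBlDl.
apply: le_trans (ler_sum _ (fun z _ => disj z)).
apply: (@le_trans _ _ (perc_prob B p
  (fun w => conn x y w && ~~ conn_off A x y w))); last first.
  apply: perc_prob_le_sum => w /bond_sub w2 /andP[xy off].
  exact: conn_through w2 xy off.
rewrite lerBlDl /tau !perc_prob_expect -perc_expectD.
apply: le_perc_expect => // w _.
rewrite /conn; case: (connect _ x y); last by rewrite addr_ge0.
by case: (conn_off _ _ _ _); rewrite ?addr0 ?add0r.
Qed.

Definition touching A : {set {set T}} := [set b : {set T} | ~~ (b \subset ~: A)].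

Lemma inner_bondsC w A : inner_bonds w (~: A) = w :\: touching A.
Proof. by apply/setP => b; rewrite !inE negbK andbC. Qed.

Lemma mem_cluster w o x : (x \in cluster w o) = conn o x w.
Proof. by rewrite inE. Qed.

(** Whether [A] is the cluster of [o] is decided by the bonds that touch [A]:
    the exploration of the cluster inspects no other bond. *)
Lemma cluster_touching w o A :
  (cluster w o == A) = (cluster (w :&: touching A) o == A).
Proof.
have sub : cluster (w :&: touching A) o \subset cluster w o.
  apply/fintype.subsetP => x; rewrite !mem_cluster.
  by apply: conn_increasing; apply: subsetIl.
suff eqc : cluster w o = A \/ cluster (w :&: touching A) o = A ->
    cluster w o = cluster (w :&: touching A) o.
  by apply/eqP/eqP => h; [rewrite -eqc //; left | rewrite eqc //; right].
move=> h; apply/eqP; rewrite eqEsubset sub andbT.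
have subA : cluster (w :&: touching A) o \subset A
  by case: h => h; [rewrite h in sub | rewrite h].
apply/fintype.subsetP => x; rewrite mem_cluster => ox.
apply: (connect_ind (P := fun t => t \in cluster (w :&: touching A) o) _ _ ox).
  by rewrite mem_cluster /conn connect0.
move=> a b _ aC ab.
move: (aC); rewrite !mem_cluster /conn => oa; apply: connect_trans oa _.
apply: connect1; rewrite /adj inE; apply/andP; split=> //; rewrite inE.
apply/negP => /fintype.subsetP/(_ a); rewrite !inE eqxx => /(_ isT).
by rewrite (fintype.subsetP subA).
Qed.

(** Given [C(o) = A], the bonds that do not touch [A] keep their law. *)
Lemma expect_cluster_off o u v x :
  perc_expect B p (fun w => (u \in cluster w o)%:R *
                            (conn_off (cluster w o) v x w)%:R) =
  perc_expect B p (fun w => (u \in cluster w o)%:R *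
                            perc_prob B p (conn_off (cluster w o) v x)).
Proof.
have decomp (F : {set T} -> {set {set T}} -> R) :
    perc_expect B p (fun w => F (cluster w o) w) =
    \sum_A perc_expect B p (fun w => (cluster w o == A)%:R * F A w).
  rewrite -perc_expect_sum; apply: eq_perc_expect => w _.
  rewrite (bigD1 (cluster w o)) //= eqxx mul1r big1 ?addr0 // => A.
  by rewrite eq_sym => /negPf->; rewrite mul0r.
rewrite (decomp (fun A w => (u \in A)%:R * (conn_off A v x w)%:R)).
rewrite (decomp (fun A w => (u \in A)%:R * perc_prob B p (conn_off A v x))).
apply: eq_bigr => A _.
transitivity ((u \in A)%:R * perc_expect B p
    (fun w => (cluster w o == A)%:R * (conn_off A v x w)%:R)).
  by rewrite -perc_expectZ; apply: eq_perc_expect => w _; rewrite mulrCA.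
rewrite (@perc_expect_indep _ _ _ (touching A)); first last.
- move=> w; rewrite /conn_off !inner_bondsC.
  by rewrite setDDl setUid.
- by move=> w; rewrite cluster_touching.
rewrite -(perc_prob_expect _ _ (conn_off A v x)) mulrCA [LHS]mulrC -perc_expectZ.
by apply: eq_perc_expect => w _; rewrite mulrC.
Qed.

(** When [uv] is a bond, the event on the right says that it is vacant and
    pivotal for the connection from [o] to [x].  Given the cluster of [o], the
    connection from [v] to [x] must avoid it, and [tau_off_ge] bounds the
    probability of this from below.  Insisting on a vacant bond keeps the full
    main term [tau o u * tau v x], because [tau_off_ge] also covers the
    clusters that contain [v]. *)
Lemma pivotal_lower o u v x :
  tau B p o u * tau B p v x -
  \sum_z perc_prob B p (fun w => conn o z w && conn o u w) *
         (tau B p v z * tau B p z x) <=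
  perc_prob B p (fun w => [&& conn o u w, conn v x w & ~~ conn o v w]).
Proof.
pose F A := tau B p v x - \sum_(z in A) tau B p v z * tau B p z x.
apply: (@le_trans _ _ (perc_expect B p
    (fun w => (u \in cluster w o)%:R * F (cluster w o)))).
  rewrite le_eqVlt; apply/orP; left; apply/eqP; rewrite /F.
  transitivity (perc_expect B p (fun w => tau B p v x * (conn o u w)%:R -
    \sum_z (tau B p v z * tau B p z x) * (conn o z w && conn o u w)%:R)).
    rewrite perc_expectB perc_expectZ perc_expect_sum mulrC /tau.
    rewrite [perc_prob B p (fun w => connect (adj w) o u)]perc_prob_expect.
    congr (_ - _); apply: eq_bigr => z _.
    by rewrite perc_expectZ perc_prob_expect mulrC.
  apply: eq_perc_expect => w _; rewrite mem_cluster mulrBr mulrC.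
  congr (_ - _); rewrite mulr_sumr [RHS]big_mkcond; apply: eq_bigr => z _.
  rewrite mem_cluster; case: (conn o z w) => /=; last by rewrite mulr0.
  by rewrite mulrC.
apply: (@le_trans _ _ (perc_expect B p
    (fun w => (u \in cluster w o)%:R *
              perc_prob B p (conn_off (cluster w o) v x)))).
  by apply: le_perc_expect => // w _; rewrite ler_wpM2l // tau_off_ge.
rewrite -expect_cluster_off perc_prob_expect; apply: le_perc_expect => // w _.
rewrite -natrM mulnb ler_nat /conn_off !mem_cluster.
case: (conn o u w) => //=; case: (conn o v w) => //=.
case E: (connect _ v x) => //=.
by have := connect_adjS (inner_bonds_sub _ _) E; rewrite /conn => ->.
Qed.

End Correlations.

(** * Invariance under graph automorphisms *)

Section Automorphisms.
Variables (R : realType) (T : finType) (B : {set {set T}}) (p : R).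
Hypothesis hB : bond_set B.
Implicit Types (x y u v : T) (w : {set {set T}}).

Lemma perc_expect_inj (g : {set T} -> {set T}) (X : {set {set T}} -> R) :
  injective g -> (forall b, (g b \in B) = (b \in B)) ->
  perc_expect B p X = perc_expect B p (fun w => X (g @: w)).
Proof.
move=> g_inj gB; rewrite /perc_expect (reindex_inj (imset_inj g_inj)).
have gBB : g @: B = B.
  apply/eqP; rewrite eqEcard card_imset // leqnn andbT.
  by apply/fintype.subsetP => _ /imsetP[b bB ->]; rewrite gB.
apply: eq_big => [w|w _].
  rewrite !powersetE; apply/fintype.subsetP/fintype.subsetP => wB b.
    by move=> bw; rewrite -gB; apply: wB; rewrite mem_imset.
  by case/imsetP => c cw ->; rewrite gB wB.
congr (_ * _); rewrite /config_prob -[in LHS]gBB big_imset /=; last first.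
  by move=> b c _ _; apply: g_inj.
by apply: eq_bigr => b _; rewrite mem_imset.
Qed.

Definition automorphism (f : {perm T}) :=
  forall u v, adj B (f u) (f v) = adj B u v.

Lemma automorphism_bond f (b : {set T}) :
  automorphism f -> (f @: b \in B) = (b \in B).
Proof.
move=> fB; have set2B (c : {set T}) : #|c| = 2%N -> (f @: c \in B) = (c \in B).
  move/eqP/cards2P => [x [y [_ ->]]]; rewrite imsetU1 imset_set1.
  exact: fB.
apply/idP/idP => bB.
  by rewrite -set2B // -(card_imset b (@perm_inj _ f)) hB.
by rewrite set2B // hB.
Qed.

Lemma conn_imset (f : {perm T}) x y w :
  conn (f x) (f y) ((fun b : {set T} => f @: b) @: w) = conn x y w.
Proof.
set gw := imset _ _; rewrite /conn.
have adjf a b : adj gw (f a) (f b) = adj w a b.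
  have -> : adj gw (f a) (f b) = (f @: [set a; b] \in gw).
    by rewrite imsetU1 imset_set1.
  by rewrite mem_imset //; apply: imset_inj (@perm_inj _ f).
apply/idP/idP => xy; last first.
  apply: (connect_ind (P := fun z => connect (adj gw) (f x) (f z)) _ _ xy) => //.
  by move=> a b _ xa ab; apply: connect_trans xa (connect1 _); rewrite adjf.
rewrite -[y](permK f).
apply: (connect_ind (P := fun z => connect (adj w) x ((f^-1)%g z)) _ _ xy).
  by rewrite permK.
move=> a b _ xa ab; apply: connect_trans xa (connect1 _).
by rewrite -adjf !permKV.
Qed.

Lemma tau_automorphism f x y : automorphism f ->
  tau B p (f x) (f y) = tau B p x y.
Proof.
move=> fB; rewrite /tau !perc_prob_expect.
rewrite (@perc_expect_inj (fun b => f @: b)); last first.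
- by move=> b; apply: automorphism_bond.
- exact: imset_inj (@perm_inj _ f).
by apply: eq_perc_expect => w _; rewrite -/(conn (f x) (f y) _) conn_imset.
Qed.

End Automorphisms.

(** * The effect of one bond on a cluster *)

Section OneBond.
Variables (R : realType) (T : finType).
Implicit Types (o x y z u v : T) (w : {set {set T}}) (b : {set T}).

(** Take a path from [x] to the cluster of [o] without [b]: its last step can
    only be [b], and the steps before avoid that cluster. *)
Lemma conn_setU1_disj o x b w : conn o x (b |: w) -> ~~ conn o x (w :\ b) ->
  exists u v, [set u; v] = b /\ disj_occur (conn o u) (conn v x) w.
Proof.
rewrite /conn connect_adjC => /connectP[p0 xp0 op0] nox.
set C := cluster (w :\ b) o.
have [||p [u [xp off vu uC]]] := path_enter (a := [in C]) xp0.
- by rewrite /= mem_cluster.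
- by rewrite -op0 /= mem_cluster /conn connect0.
set v := last x p in vu; have nvC : v \notin C by apply: off; apply: mem_last.
have bE : [set v; u] = b.
  apply/eqP; apply: contraNT nvC => nb; rewrite mem_cluster /conn.
  rewrite mem_cluster in uC; apply: connect_trans uC (connect1 _).
  by rewrite adj_sym; move: vu; rewrite /adj !inE (negPf nb).
exists u, v; split; first by rewrite setUC.
apply/existsP; exists (touching C); apply/andP; split.
  have : u \in cluster ((w :\ b) :&: touching C) o.
    suff /eqP-> : cluster ((w :\ b) :&: touching C) o == C by [].
    by rewrite -cluster_touching.
  by rewrite mem_cluster; apply: conn_increasing; apply: setSI; apply: subD1set.
rewrite /conn connect_adjC -inner_bondsC.
have : connect (adj (inner_bonds (b |: w) (~: C))) x v.
  by apply: path_connect_inner xp _ => t /off; rewrite in_setC.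
apply: connect_adjS; apply/fintype.subsetP => c; rewrite !inE.
case/andP => /orP[/eqP-> | ->] // /fintype.subsetP/(_ u).
by rewrite -bE in_set2 eqxx orbT in_setC uC => /(_ isT).

Qed.

End OneBond.

(** * Differential inequalities for the susceptibility *)

Section DifferentialInequality.
Variables (R : realType) (T : finType) (B : {set {set T}}) (Omega : nat).
Hypotheses (hB : bond_set B) (htrans : transitive_graph B).
Hypothesis hdeg : forall x : T, degree B x = Omega.
Implicit Types (p : R) (o x y z u v : T) (w : {set {set T}}) (b : {set T}).

Lemma card_neighbours u : #|[pred v | adj B u v]| = Omega.
Proof.
rewrite -(hdeg u) /degree; set N := [set b in B | u \in b].
have nuv v : adj B u v -> v != u.
  by move=> /hB; apply: contra_eq_neq => ->; rewrite setUid cards1.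
have -> : N = [set [set u; v] | v in [pred v | adj B u v]].
  apply/setP => b; rewrite inE; apply/andP/imsetP => [[bB ub]|[v uv ->]].
    have := hB bB; rewrite (cardsD1 u) ub add1n => -[/eqP/cards1P[v bv]].
    have Eb : b = [set u; v] by rewrite -bv setD1K.
    by exists v => //; rewrite inE /adj -Eb.
  by rewrite inE in uv; split=> //; rewrite set21.
rewrite card_in_imset // => v v'; rewrite !inE => /nuv vu _ Evv'.
have : v \in [set u; v'] by rewrite -Evv' set22.
by rewrite !inE (negPf vu) => /eqP.
Qed.

Lemma sum_neighbours (F : T -> R) :
  \sum_u \sum_(v | adj B u v) F u = Omega%:R * \sum_u F u.
Proof.
rewrite mulr_sumr; apply: eq_bigr => u _.
by rewrite sumr_const card_neighbours mulr_natl.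
Qed.

Lemma sum_bonds (F : T -> T -> R) :
  \sum_(b in B) \sum_(uv : T * T | [set uv.1; uv.2] == b) F uv.1 uv.2 =
  \sum_u \sum_(v | adj B u v) F u v.
Proof.
rewrite [RHS]pair_big_dep /=.
rewrite [RHS](partition_big (fun uv : T * T => [set uv.1; uv.2]) (mem B)) //=.
apply: eq_bigr => b bB; apply: eq_bigl => uv; rewrite /adj.
by case: eqP => [->|]; rewrite ?bB ?andbF.
Qed.

Lemma chi_sum_tau o p : chi B o p = \sum_x tau B p o x.
Proof.
under eq_bigr do rewrite /tau perc_prob_expect.
rewrite -perc_expect_sum; apply: eq_perc_expect => w _.
rewrite -sum1_card natr_sum big_mkcond; apply: eq_bigr => x _.
by rewrite mem_cluster /conn; case: connect.
Qed.

Lemma chi_transitive o o' p : chi B o p = chi B o' p.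
Proof.
have [f [fB <-]] := htrans o o'; rewrite !chi_sum_tau.
rewrite [RHS](reindex_inj (@perm_inj _ f)) /=.
by apply: eq_bigr => x _; rewrite tau_automorphism.
Qed.

Lemma chi_ge1 o p : 0 <= p <= 1 -> 1 <= chi B o p.
Proof.
move=> p01; rewrite -[leLHS](perc_expect_cst B p).
apply: le_perc_expect => // w _; rewrite ler1n card_gt0.
by apply/set0Pn; exists o; rewrite mem_cluster /conn connect0.
Qed.

Lemma chi_p0 o : chi B o (0 : R) = 1.
Proof.
rewrite /chi perc_expect_p0; suff -> : cluster set0 o = [set o] by rewrite cards1.
apply/setP => x; rewrite mem_cluster inE /conn.
apply/connectP/eqP => [[[|y p] /=]|->]; last by exists [::].
  by [].
by rewrite /adj inE.
Qed.

Lemma chi_p1 o : connected_graph B -> chi B o (1 : R) = #|T|%:R.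
Proof.
move=> hconn; rewrite /chi perc_expect_p1; congr (_%:R).
by apply: eq_card => x; rewrite mem_cluster /conn hconn.
Qed.

(** Russo's formula for the susceptibility, one endpoint [x] at a time. *)
Definition dchi o p : R :=
  \sum_(b in B) \sum_x (perc_prob B p (fun w => conn o x (b |: w)) -
                        perc_prob B p (fun w => conn o x (w :\ b))).

Lemma chi_is_derive o p : is_derive p 1 (chi B o) (dchi o p).
Proof.
rewrite /chi.
have := perc_expect_deriv B (fun w => #|cluster w o|%:R) p.
suff -> : \sum_(b in B) perc_expect B p (fun w =>
  #|cluster (b |: w) o|%:R - #|cluster (w :\ b) o|%:R) = dchi o p by [].
apply: eq_bigr => b _.
under [RHS]eq_bigr do rewrite !perc_prob_expect -perc_expectB.
rewrite -perc_expect_sum; apply: eq_perc_expect => w _; rewrite sumrB.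
have card_conn w' : #|cluster w' o|%:R = \sum_x (conn o x w')%:R :> R.
  rewrite -sum1_card natr_sum big_mkcond; apply: eq_bigr => x _.
  by rewrite mem_cluster; case: conn.
by rewrite !card_conn.
Qed.

(** Each occurrence of [b] as a pivotal bond is charged to an orientation of
    [b]: towards [u] from [o], then from [v] to [x]. *)
Lemma influence_upper o x b p : 0 <= p <= 1 ->
  perc_prob B p (fun w => conn o x (b |: w)) -
  perc_prob B p (fun w => conn o x (w :\ b)) <=
  \sum_(uv : T * T | [set uv.1; uv.2] == b) tau B p o uv.1 * tau B p uv.2 x.
Proof.
move=> p01; apply: (@le_trans _ _ (\sum_(uv : T * T | [set uv.1; uv.2] == b)
    perc_prob B p (disj_occur (conn o uv.1) (conn uv.2 x)))); last first.
  by apply: ler_sum => uv _; apply: BK_inequality => //; apply: conn_increasing.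
rewrite !perc_prob_expect -perc_expectB.
under eq_bigr do rewrite perc_prob_expect.
rewrite -perc_expect_sum; apply: le_perc_expect => // w _.
case h1: (conn o x (b |: w)); last first.
  by rewrite sub0r; apply: le_trans (sumr_ge0 _ _) => //; rewrite oppr_le0.
case h0: (conn o x (w :\ b)); first by rewrite subrr sumr_ge0.
have [||u [v [uvb disj]]] := @conn_setU1_disj _ o x b w; rewrite ?h1 ?h0 //.
rewrite subr0 (bigD1 (u, v)) /=; last by rewrite uvb.
by rewrite disj lerDl sumr_ge0.
Qed.

(** The events of the two orientations of [b] exclude each other, and each of
    them forces [b] to be vacant and pivotal. *)
Lemma influence_lower o x b p : 0 <= p <= 1 ->
  \sum_(uv : T * T | [set uv.1; uv.2] == b)
    perc_prob B p (fun w => [&& conn o uv.1 w, conn uv.2 x w & ~~ conn o uv.2 w])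
  <= perc_prob B p (fun w => conn o x (b |: w)) -
     perc_prob B p (fun w => conn o x (w :\ b)).
Proof.
move=> p01; rewrite !perc_prob_expect -perc_expectB.
under eq_bigr do rewrite perc_prob_expect.
rewrite -perc_expect_sum; apply: le_perc_expect => // w _.
pose E (uv : T * T) := [&& conn o uv.1 w, conn uv.2 x w & ~~ conn o uv.2 w].
rewrite -[leLHS]/(\sum_(uv : T * T | [set uv.1; uv.2] == b) (E uv)%:R).
have mono : conn o x (w :\ b) -> conn o x (b |: w).
  apply: conn_increasing.
  exact: fintype.subset_trans (subD1set _ _) (subsetU1 _ _).
have [[u v] /andP[/eqP uvb Euv]|none] :=
    pickP (fun uv => ([set uv.1; uv.2] == b) && E uv); last first.
  rewrite big1 => [|uv uvb]; last by have := none uv; rewrite uvb /E /= => ->.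
  by rewrite subr_ge0 ler_nat; case: conn mono => // ->.
have /and3P[/= ou vx nov] := Euv.
rewrite (bigD1 (u, v)) /=; last by rewrite uvb.
rewrite Euv.
have nbw : b \notin w.
  apply: contra nov => bw; apply: connect_trans ou (connect1 _).
  by rewrite /adj uvb.
rewrite big1 ?addr0 => [|[u' v'] /andP[/eqP /= uvb' ne]]; last first.
  case: (boolP (E _)) => // /and3P[/= ou' vx' nov'].
  have : v \in [set u'; v'] by rewrite uvb' -uvb set22.
  rewrite !inE => /orP[/eqP E'|/eqP E']; first by rewrite E' ou' in nov.
  have : u \in [set u'; v'] by rewrite uvb' -uvb set21.
  rewrite !inE => /orP[/eqP E''|/eqP E'']; last by rewrite -E'' ou in nov'.
  by rewrite E' E'' eqxx in ne.
have -> : conn o x (b |: w).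
  have iw := subsetU1 b w.
  apply: connect_trans (conn_increasing iw ou) _.
  apply: connect_trans (connect1 _) (conn_increasing iw vx).
  by rewrite /adj uvb setU11.
suff /negPf-> : ~~ conn o x (w :\ b) by rewrite subr0.
apply: contra nov => /(conn_increasing (subD1set w b)) ox.
by apply: connect_trans ox _; rewrite connect_adjC.
Qed.

Lemma dchi_ge0 o p : 0 <= p <= 1 -> 0 <= dchi o p.
Proof.
move=> p01; apply: sumr_ge0 => b _; apply: sumr_ge0 => x _; rewrite subr_ge0.
apply: le_perc_prob => // w _; apply: conn_increasing.
exact: fintype.subset_trans (subD1set _ _) (subsetU1 _ _).
Qed.

Lemma dchi_upper o p : 0 <= p <= 1 -> dchi o p <= Omega%:R * chi B o p ^+ 2.
Proof.
move=> p01.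
have -> : Omega%:R * chi B o p ^+ 2 =
    \sum_(b in B) \sum_x \sum_(uv : T * T | [set uv.1; uv.2] == b)
      tau B p o uv.1 * tau B p uv.2 x.
  under eq_bigr do rewrite exchange_big /=.
  rewrite (sum_bonds (fun u v => \sum_x tau B p o u * tau B p v x)).
  rewrite expr2 mulrA {1}chi_sum_tau -sum_neighbours mulr_suml.
  apply: eq_bigr => u _; rewrite mulr_suml; apply: eq_bigr => v _.
  by rewrite -mulr_sumr -chi_sum_tau (chi_transitive v o).
by apply: ler_sum => b _; apply: ler_sum => x _; apply: influence_upper.
Qed.

(** The part of the triangle diagrams between the ends of a bond, summed over
    all oriented bonds, in which the first inner vertex is [y]. *)
Definition corner_triangles p y : R :=
  \sum_u \sum_(v | adj B u v) \sum_z tau B p y u * (tau B p y z * tau B p v z).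

(** By transitivity [corner_triangles] does not depend on [y]; on average it
    is a sum of triangle diagrams over the oriented bonds. *)
Lemma corner_triangles_le p M y : 0 <= p <= 1 ->
  (forall u v, adj B u v -> triangle B p u v <= M) ->
  corner_triangles p y <= Omega%:R * M.
Proof.
move=> p01 hM; have V0 : 0 < #|T|%:R :> R.
  by rewrite ltr0n; apply/card_gt0P; exists y.
have cst y' : corner_triangles p y' = corner_triangles p y.
  have [f [fB <-]] := htrans y y'.
  rewrite /corner_triangles (reindex_inj (@perm_inj _ f)) /=.
  apply: eq_bigr => u _; rewrite (reindex_inj (@perm_inj _ f)) /=.
  apply: eq_big => [v|v _]; first exact: fB.
  rewrite (reindex_inj (@perm_inj _ f)) /=; apply: eq_bigr => z _.
  by rewrite !tau_automorphism.
rewrite -(ler_pM2l V0); have -> : #|T|%:R * corner_triangles p y =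
    \sum_y corner_triangles p y.
  by under eq_bigr do rewrite cst; rewrite sumr_const mulr_natl.
rewrite exchange_big /=.
apply: (@le_trans _ _ (\sum_u \sum_(v | adj B u v) M)); last first.
  by rewrite (sum_neighbours (fun=> M)) sumr_const -[M *+ _]mulr_natl mulrCA.
apply: ler_sum => u _; rewrite exchange_big /=; apply: ler_sum => v uv.
apply: le_trans (hM u v uv); rewrite /triangle le_eqVlt; apply/orP; left.
apply/eqP; apply: eq_bigr => y' _; apply: eq_bigr => z _.
by rewrite (tauC _ _ u) (tauC _ _ z v) mulrA.
Qed.

(** The error terms of [pivotal_lower] are summed over [x] first, which leaves
    a factor [chi]; the tree-graph inequality turns the rest into the sum over
    [y] of [tau o y * corner_triangles y]. *)
Lemma dchi_lower o p M : 0 <= p <= 1 ->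
  (forall u v, adj B u v -> triangle B p u v <= M) ->
  (1 - M) * Omega%:R * chi B o p ^+ 2 <= dchi o p.
Proof.
move=> p01 hM; set Y := chi B o p.
have Y0 : 0 <= Y by apply: le_trans (chi_ge1 o p01).
have sumY v : \sum_x tau B p v x = Y by rewrite -chi_sum_tau (chi_transitive v o).
pose three u z := perc_prob B p (fun w => conn o z w && conn o u w).
apply: (@le_trans _ _ (\sum_(b in B) \sum_x
    \sum_(uv : T * T | [set uv.1; uv.2] == b)
      (tau B p o uv.1 * tau B p uv.2 x -
       \sum_z three uv.1 z * (tau B p uv.2 z * tau B p z x)))); last first.
  apply: ler_sum => b _; apply: ler_sum => x _.
  apply: le_trans (influence_lower _ _ _ p01).
  by apply: ler_sum => uv _; apply: pivotal_lower.
under eq_bigr do rewrite exchange_big /=.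
rewrite (sum_bonds (fun u v => \sum_x (tau B p o u * tau B p v x -
       \sum_z three u z * (tau B p v z * tau B p z x)))).
apply: (@le_trans _ _ (\sum_u \sum_(v | adj B u v)
    (Y * tau B p o u - Y * \sum_y \sum_z
       tau B p o y * (tau B p y u * (tau B p y z * tau B p v z)))));
  last first.
  apply: ler_sum => u _; apply: ler_sum => v _.
  rewrite sumrB -mulr_sumr sumY mulrC lerD2l lerN2 exchange_big /=.
  rewrite [X in _ <= _ * X]exchange_big /= mulr_sumr; apply: ler_sum => z _.
  have -> : \sum_x three u z * (tau B p v z * tau B p z x) =
      Y * (three u z * tau B p v z).
    by rewrite -2!mulr_sumr sumY mulrA mulrC.
  rewrite ler_wpM2l //.
  have := tree_graph_inequality hB p01 o z u.
  move=> /(ler_wpM2r (tau_ge0 B p01 v z)).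
  move/le_trans; apply; rewrite le_eqVlt; apply/orP; left; apply/eqP.
  by rewrite mulr_suml; apply: eq_bigr => y _; rewrite !mulrA.
under eq_bigr do rewrite sumrB.
rewrite sumrB sum_neighbours -mulr_sumr sumY.
under [X in _ <= _ - X]eq_bigr do rewrite -mulr_sumr.
rewrite -mulr_sumr.
have -> : \sum_u \sum_(v | adj B u v) \sum_y \sum_z
     tau B p o y * (tau B p y u * (tau B p y z * tau B p v z)) =
   \sum_y tau B p o y * corner_triangles p y.
  under eq_bigr do rewrite exchange_big /=.
  rewrite exchange_big /=; apply: eq_bigr => y _; rewrite mulr_sumr.
  apply: eq_bigr => u _; rewrite mulr_sumr; apply: eq_bigr => v _.
  by rewrite mulr_sumr.
have : \sum_y tau B p o y * corner_triangles p y <= Y * (Omega%:R * M).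
  rewrite -[Y in Y * _](sumY o) mulr_suml; apply: ler_sum => y _.
  by rewrite ler_wpM2l ?tau_ge0 ?corner_triangles_le.
move=> /(ler_wpM2l Y0); set Z := \sum_y _ => h.
have -> : (1 - M) * Omega%:R * Y ^+ 2 =
    Omega%:R * (Y * Y) - Y * (Y * (Omega%:R * M)) by ring.
by rewrite lerD2l lerN2.
Qed.

End DifferentialInequality.

(** * Integration of the differential inequalities *)

Section Integration.
Variable R : realType.
Implicit Types (f g df dg : R -> R) (a b s t c : R).

Lemma le_increment f g df dg a b : a <= b ->
  (forall t, a <= t <= b -> is_derive t 1 f (df t)) ->
  (forall t, a <= t <= b -> is_derive t 1 g (dg t)) ->
  (forall t, a <= t <= b -> df t <= dg t) -> f b - f a <= g b - g a.
Proof.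
move=> ab f' g' fg.
have fg' t : a <= t <= b -> is_derive t 1 (f - g) (df t - dg t).
  by move=> tab; apply: is_deriveB; [apply: f' | apply: g'].
have [||t tab E] := @MVT_segment R (f - g) (fun t => df t - dg t) a b ab.
- by move=> t; rewrite in_itv /= => /andP[at_ tb]; apply: fg'; rewrite !ltW.
- apply: derivable_within_continuous => t; rewrite in_itv /= => tab.
  by have [] := fg' t tab.
have : (f - g) b - (f - g) a <= 0.
  rewrite E; apply: mulr_le0_ge0; last by rewrite subr_ge0.
  by rewrite subr_le0; apply: fg; rewrite in_itv in tab.
rewrite (_ : (f - g) b = f b - g b) // (_ : (f - g) a = f a - g a) //.
by lra.
Qed.

Lemma is_derive_mul_cst c t : is_derive t 1 (fun s => c * s) c.
Proof.
have -> : (fun s => c * s) = c \*: id by [].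
by apply: is_derive_eq; rewrite /GRing.scale /= mulr1.
Qed.

Lemma is_derive_inv f df t : f t != 0 -> is_derive t 1 f (df t) ->
  is_derive t 1 (fun s => (f s)^-1) (- (df t / f t ^+ 2)).
Proof.
move=> ft0 f'; have := is_deriveV ft0 f'.
by rewrite /GRing.scale /= mulNr mulrC.
Qed.

Variables (chi dchi : R -> R) (Omega s pc : R).
Hypotheses (Omega_gt0 : 0 < Omega) (spc : s <= pc).
Hypothesis chi_gt0 : forall t, s <= t <= pc -> 0 < chi t.
Hypothesis chi' : forall t, s <= t <= pc -> is_derive t 1 chi (dchi t).

Let inv_chi' t : s <= t <= pc ->
  is_derive t 1 (fun t => (chi t)^-1) (- (dchi t / chi t ^+ 2)).
Proof.
by move=> st; apply: is_derive_inv; [rewrite gt_eqF // chi_gt0 | apply: chi'].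
Qed.

Let chi2_gt0 t : s <= t <= pc -> 0 < chi t ^+ 2.
Proof. by move=> st; rewrite exprn_gt0 // chi_gt0. Qed.

Lemma inv_chi_le :
  (forall t, s <= t <= pc -> dchi t <= Omega * chi t ^+ 2) ->
  (chi s)^-1 <= (chi pc)^-1 + Omega * (pc - s).
Proof.
move=> ub.
have := le_increment spc (fun t _ => is_derive_mul_cst (- Omega) t) inv_chi'.
have h t : s <= t <= pc -> - Omega <= - (dchi t / chi t ^+ 2).
  by move=> st; rewrite lerN2 ler_pdivrMr ?chi2_gt0 // ub.
move=> /(_ h); lra.
Qed.

Lemma inv_chi_ge c :
  (forall t, s <= t <= pc -> c * Omega * chi t ^+ 2 <= dchi t) ->
  (chi pc)^-1 + c * (Omega * (pc - s)) <= (chi s)^-1.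
Proof.
move=> lb.
have := le_increment spc inv_chi'
  (fun t _ => is_derive_mul_cst (- (c * Omega)) t).
have h t : s <= t <= pc -> - (dchi t / chi t ^+ 2) <= - (c * Omega).
  by move=> st; rewrite lerN2 ler_pdivlMr ?chi2_gt0 // lb.
move=> /(_ h); lra.
Qed.

(** With [r := e / (e + c eps)] the bound [chi t <= 1 / (e + c eps)] gives
    [e chi t <= r <= 1], hence [(e chi t)^3 <= r^2]; and [eps r] is the
    primitive of [r^2] that vanishes at [eps = 0]. *)
Lemma inv_chi_ge_improved (K L : R) :
  let e := (chi pc)^-1 in let c := 1 - (K + L) in
  let eps := fun t => Omega * (pc - t) in
  0 <= L -> 0 < c ->
  (forall t, s <= t <= pc -> e + c * eps t <= (chi t)^-1) ->
  (forall t, s <= t <= pc ->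
     (1 - (K + L * (e * chi t) ^+ 3)) * Omega * chi t ^+ 2 <= dchi t) ->
  e + (1 - (K + L * (e / (e + c * eps s)))) * eps s <= (chi s)^-1.
Proof.
move=> e c eps L0 c0 first_bound lb.
have e0 : 0 < e by rewrite invr_gt0 chi_gt0 // spc lexx.
have eps0 t : s <= t <= pc -> 0 <= eps t.
  by move=> /andP[_ tpc]; rewrite mulr_ge0 ?subr_ge0 // ltW.
pose V t := e + c * eps t.
have V0 t : s <= t <= pc -> 0 < V t.
  by move=> st; rewrite ltr_wpDr // mulr_ge0 ?eps0 // ltW.
have V' t : is_derive t 1 V (- (c * Omega)).
  have -> : V = cst (e + c * Omega * pc) + (fun t => - (c * Omega) * t).
    by apply: funext => u; rewrite /V /eps /= /cst !fctE; ring.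
  rewrite -[X in is_derive _ _ _ X]add0r.
  exact: is_deriveD (is_derive_mul_cst _ _).
(* Since [c eps = V - e], the term [eps * (e / V)] equals
   [(e - e ^ 2 / V) / c].  So the bound to be proved is an affine function of
   [s] plus [k / V s]. *)
pose k := L * e ^+ 2 / c.
pose dg t := - ((1 - K) * Omega) + k * (c * Omega / V t ^+ 2).
have g' t : s <= t <= pc ->
    is_derive t 1
      ((fun t => - ((1 - K) * Omega) * t) + k \*: (fun t => (V t)^-1)) (dg t).
  move=> st; apply: is_deriveD; first exact: is_derive_mul_cst.
  have := is_deriveZ k (is_derive_inv (negbT (gt_eqF (V0 t st))) (V' t)).
  by rewrite /GRing.scale /= mulNr opprK.
have h t : s <= t <= pc -> - (dchi t / chi t ^+ 2) <= dg t.
  move=> st; have ct := chi_gt0 st; have vt := V0 t st.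
  have : (1 - (K + L * (e * chi t) ^+ 3)) * Omega <= dchi t / chi t ^+ 2.
    by rewrite ler_pdivlMr ?chi2_gt0 // lb.
  have chi_V : chi t <= (V t)^-1.
    by rewrite -[chi t]invrK lef_pV2 ?posrE ?invr_gt0 // first_bound.
  have eV : e * chi t <= 1.
    apply: (@le_trans _ _ (e * (V t)^-1)); first by rewrite ler_pM2l.
    by rewrite ler_pdivrMr // mul1r lerDl mulr_ge0 ?eps0 // ltW.
  have cube : (e * chi t) ^+ 3 <= e ^+ 2 * (V t) ^- 2.
    apply: (@le_trans _ _ ((e * chi t) ^+ 2)).
      by rewrite exprS ler_piMl // exprn_ge0 // mulr_ge0 // ltW.
    have ec0 : 0 <= e * chi t by rewrite mulr_ge0 // ltW.
    have eV0 : 0 <= e * (V t)^-1.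
      by apply: mulr_ge0; [exact: ltW | rewrite invr_ge0 ltW].
    by rewrite -exprVn -exprMn ler_sqr // ler_pM2l.
  have -> : dg t = - ((1 - K) * Omega) + L * (e ^+ 2 * (V t) ^- 2) * Omega.
    by rewrite /dg /k; field; rewrite ?gt_eqF.
  have : L * (e * chi t) ^+ 3 * Omega <= L * (e ^+ 2 * (V t) ^- 2) * Omega.
    by rewrite ler_wpM2r ?(ltW Omega_gt0) // ler_wpM2l.
  by lra.
have := le_increment spc inv_chi' g' h.
have gE t : ((fun t => - ((1 - K) * Omega) * t) + k \*: (fun t => (V t)^-1)) t =
    - ((1 - K) * Omega) * t + k * (V t)^-1 by [].
rewrite !gE.
have Vpc : V pc = e by rewrite /V /eps subrr !mulr0 addr0.
rewrite /= -/e -/(V s) Vpc.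
have -> : e + (1 - (K + L * (e / V s))) * eps s =
    e + (1 - K) * eps s - k * e^-1 + k * (V s)^-1.
  have Vs := V0 s; rewrite lexx spc in Vs; have {}Vs := Vs isT.
  have -> : eps s = (V s - e) / c.
    by rewrite /V [e + _]addrC addrK mulrC mulKf // gt_eqF.
  by rewrite /k; field; rewrite !gt_eqF.
by rewrite /eps; lra.
Qed.

End Integration.

(** * The critical threshold *)

Section Threshold.
Variables (R : realType) (T : finType) (B : {set {set T}}) (o : T) (lambda : R).
Hypotheses (hB : bond_set B) (hconn : connected_graph B).
Hypothesis hwindow : 1 < lambda * #|T|%:R `^ (3%:R^-1) < #|T|%:R.

(** [chi] is differentiable, hence continuous, and runs from [1] to [V]. *)
Lemma p_critP :
  0 <= p_crit B o lambda <= 1 /\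
  chi B o (p_crit B o lambda) = lambda * #|T|%:R `^ (3%:R^-1).
Proof.
apply: (@xgetPex _ 0 (fun p : R => 0 <= p <= 1 /\
  chi B o p = lambda * #|T|%:R `^ (3%:R^-1))).
have [|||p p01 chip] := @IVT R (chi B o) 0 1 (lambda * #|T|%:R `^ (3%:R^-1)).
- exact: ler01.
- apply: derivable_within_continuous => t _.
  by have [] := chi_is_derive B o t.
- rewrite chi_p0 chi_p1 //; case/andP: hwindow => l1 l2.
  by rewrite min_l ?max_r ?(ltW l1) ?(ltW l2) // (ltW (lt_trans l1 l2)).
by exists p; split=> //; move: p01; rewrite in_itv.
Qed.

Lemma chi_p_crit_cube :
  chi B o (p_crit B o lambda) ^+ 3 = lambda ^+ 3 * #|T|%:R.
Proof.
have [_ ->] := p_critP; rewrite exprMn -(powR_mulrn 3 (powR_ge0 _ _)).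
by rewrite -powRrM mulVf ?powRr1 ?ler0n // pnatr_eq0.
Qed.

(** The window forces [1 < V], hence a second vertex. *)
Lemma exists_neighbour : exists v, adj B o v.
Proof.
have : 1 < #|T|%:R :> R by case/andP: hwindow; apply: lt_trans.
rewrite ltr1n (cardD1 o) ltnS => /card_gt0P[y].
rewrite !inE andbT => yo; have /connectP[[|v p] /=] := hconn o y.
  by move=> _ E; rewrite E eqxx in yo.
by case/andP => ov _ _; exists v.
Qed.

End Threshold.

Theorem theorem1p5 (R : realType) (T : finType) (B : {set {set T}})
    (Omega : nat) (o : T) (lambda K1 K2 : R)
    (hB : bond_set B)
    (hconn : connected_graph B)
    (htrans : transitive_graph B)
    (hdeg : forall x : T, degree B x = Omega)
    (hlambda : 0 < lambda)
    (hwindow : 1 < lambda * #|T|%:R `^ (3%:R^-1) < #|T|%:R)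
    (hK2 : 0 <= K2) :
  let V : R := #|T|%:R in
  let pc : R := p_crit B o lambda in
  let a : R := K1 / Omega%:R + K2 * lambda ^+ 3 in
  let eps0 : R := (chi B o pc)^-1 in
  let K2t : R := K2 / (1 - a) in
  let atilde (eps : R) : R :=
    K1 / Omega%:R
      + K2 * lambda ^+ 3 * (eps0 / (eps0 + (1 - a) * eps)) in
  (forall (x y : T) (p : R), 0 <= p <= pc ->
     triangle B p x y
       <= (x == y)%:R + K1 / Omega%:R + K2 * (chi B o p ^+ 3 / V)) ->
  a < 1 ->
  (1 - eps0 <= Omega%:R * pc /\
   (0 < 1 - K1 / Omega%:R - K2t * lambda ^+ 3 * eps0 ->
    Omega%:R * pc
      <= (1 - eps0) / (1 - K1 / Omega%:R - K2t * lambda ^+ 3 * eps0))) /\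
  (forall eps : R, 0 <= eps ->
     let p : R := pc - eps / Omega%:R in
     0 <= p <= 1 ->
     1 / (eps0 + eps) <= chi B o p
       <= 1 / (eps0 + (1 - atilde eps) * eps)).
Proof.
move=> V pc a eps0 K2t atilde hdiag a1.
have [pc01 chi_pc] := p_critP o hconn hwindow.
rewrite -/pc in pc01 chi_pc; case/andP: (pc01) => pc0 pc1.
have [v0 ov0] := exists_neighbour o hconn hwindow.
have V0 : 0 < V by rewrite ltr0n; apply/card_gt0P; exists o.
have Omega0 : 0 < Omega%:R :> R.
  rewrite ltr0n -(card_neighbours hB hdeg o); apply/card_gt0P.
  by exists v0; rewrite inE.
have c0 : 0 < 1 - a by rewrite subr_gt0.
have chi0 (p : R) : 0 <= p <= 1 -> 0 < chi B o p.
  by move=> /(chi_ge1 B o); apply: lt_le_trans.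
have e0 : 0 < eps0 by rewrite invr_gt0 chi0.
pose K := K1 / Omega%:R; pose L := K2 * lambda ^+ 3.
have L0 : 0 <= L by rewrite mulr_ge0 // exprn_ge0 // ltW.
have in01 (t : R) : 0 <= t <= pc -> 0 <= t <= 1.
  by case/andP => -> /le_trans ->.
have chi_le (t : R) : 0 <= t <= pc -> chi B o t <= chi B o pc.
  case/andP => t0 tpc.
  have := le_increment tpc (fun u _ => is_derive_mul_cst 0 u)
    (fun u _ => chi_is_derive B o u).
  rewrite !mul0r subrr subr_ge0; apply=> u /andP[tu upc].
  by apply: dchi_ge0; apply: in01; rewrite (le_trans t0 tu).
(* The definition of [pc] reads [1 / V = lambda ^ 3 * eps0 ^ 3]. *)
have V_eps0 (x : R) : K2 * (x ^+ 3 / V) = L * (eps0 * x) ^+ 3.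
  have := chi_p_crit_cube o hconn hwindow; rewrite -/pc -/V => cube.
  have -> : (eps0 * x) ^+ 3 = x ^+ 3 / (lambda ^+ 3 * V).
    by rewrite exprMn exprVn cube mulrC.
  by rewrite /L; field; rewrite !gt_eqF.
have triangle_le u v (t : R) : 0 <= t <= pc -> adj B u v ->
    triangle B t u v <= K + L * (eps0 * chi B o t) ^+ 3.
  move=> tpc uv; apply: le_trans (hdiag u v t tpc) _.
  suff /negPf-> : u != v by rewrite add0r V_eps0.
  by move/hB: uv; apply: contra_eq_neq => ->; rewrite setUid cards1.
have lower (t : R) : 0 <= t <= pc ->
    (1 - (K + L * (eps0 * chi B o t) ^+ 3)) * Omega%:R * chi B o t ^+ 2 <=
    dchi B o t.
  move=> tpc; apply: (dchi_lower hB htrans hdeg); first exact: in01.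
  by move=> u v; apply: triangle_le.
have eps_chi (t : R) : 0 <= t <= pc -> 0 <= eps0 * chi B o t <= 1.
  move=> tpc; rewrite mulr_ge0 ?(ltW e0) ?(ltW (chi0 _ (in01 _ tpc))) //=.
  by rewrite mulrC ler_pdivrMr ?mul1r ?chi_le // chi0.
(* [a] bounds the triangle diagram at two neighbours when [p = pc]. *)
have a0 : 0 <= a.
  have pcpc : 0 <= pc <= pc by rewrite pc0 lexx.
  apply: le_trans (_ : triangle B pc o v0 <= _).
    apply: sumr_ge0 => u _; apply: sumr_ge0 => v _.
    by rewrite !mulr_ge0 ?tau_ge0.
  apply: le_trans (triangle_le _ _ _ pcpc ov0) _.
  by rewrite mulVf ?gt_eqF ?chi0 // expr1n mulr1.
have first_bound (s : R) : 0 <= s <= pc ->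
    eps0 + (1 - a) * (Omega%:R * (pc - s)) <= (chi B o s)^-1.
  case/andP => s0 spc.
  have sub (t : R) : s <= t <= pc -> 0 <= t <= pc.
    by case/andP => st ->; rewrite (le_trans s0 st).
  have pos (t : R) : s <= t <= pc -> 0 < chi B o t by move=> /sub/in01/chi0.
  apply: (inv_chi_ge spc pos (fun t _ => chi_is_derive B o t)) => t /sub tpc.
  apply: le_trans (lower t tpc); rewrite -[leLHS]mulrA -[leRHS]mulrA ler_wpM2r //.
    by rewrite mulr_ge0 ?exprn_ge0 // ltW // chi0 // in01.
rewrite lerD2l lerN2 /a -/K -/L lerD2l ler_piMr //.
  by have /andP[? ?] := eps_chi t tpc; rewrite exprn_ile1.
have bounds (s : R) : 0 <= s <= pc -> let eps := Omega%:R * (pc - s) in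
    eps0 + (1 - atilde eps) * eps <= (chi B o s)^-1 <= eps0 + eps.
  case/andP => s0 spc.
  have sub (t : R) : s <= t <= pc -> 0 <= t <= pc.
    by case/andP => st ->; rewrite (le_trans s0 st).
  have pos (t : R) : s <= t <= pc -> 0 < chi B o t by move=> /sub/in01/chi0.
  apply/andP; split.
    apply: (inv_chi_ge_improved Omega0 spc pos
      (fun t _ => chi_is_derive B o t) L0 c0) => t /sub.
      exact: first_bound.
    exact: lower.
  apply: (inv_chi_le spc pos (fun t _ => chi_is_derive B o t)) => t /sub tpc.
  exact: (dchi_upper hB htrans hdeg _ (in01 _ tpc)).
split.
  have := bounds 0; rewrite lexx pc0 => /(_ isT); rewrite chi_p0 invr1 subr0 /=.
  set eps := Omega%:R * pc => /andP[lo hi].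
  rewrite -/K; split=> [|d0]; first by lra.
  rewrite ler_pdivlMr //.
  have eps_ge0 : 0 <= eps by rewrite mulr_ge0 // ltW.
  have den : 1 - a <= eps0 + (1 - a) * eps.
    have : (1 - a) * (1 - eps0) <= (1 - a) * eps by rewrite ler_pM2l //; lra.
    have : 0 <= a * eps0 by rewrite mulr_ge0 // ltW.
    by lra.
  have at_le : atilde eps <= K + K2t * lambda ^+ 3 * eps0.
    rewrite lerD2l.
    have -> : K2t * lambda ^+ 3 * eps0 = L * (eps0 / (1 - a)).
      by rewrite /K2t /L; field; rewrite gt_eqF.
    rewrite ler_wpM2l // ler_pM2l // lef_pV2 ?posrE //.
    exact: lt_le_trans den.
  have : atilde eps * eps <= (K + K2t * lambda ^+ 3 * eps0) * eps.
    by rewrite ler_wpM2r.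
  by lra.
move=> eps eps_ge0 p /andP[p0 p1].
have pE : Omega%:R * (pc - p) = eps by rewrite /p; field; rewrite gt_eqF.
have ppc : 0 <= p <= pc.
  by rewrite p0 -subr_ge0 -(pmulr_rge0 _ Omega0) pE.
have := bounds p ppc; rewrite pE /= => /andP[lo hi].
have chip := chi0 p (in01 p ppc).
have den : 0 < eps0 + (1 - atilde eps) * eps.
  rewrite ltr_wpDr // mulr_ge0 // subr_ge0; apply: le_trans (ltW a1).
  rewrite lerD2l ler_piMr // ler_pdivrMr; last first.
    by rewrite ltr_wpDr // mulr_ge0 // ltW.
  by rewrite mul1r lerDl mulr_ge0 // ltW.
rewrite !div1r -[chi B o p]invrK !lef_pV2 ?posrE ?invr_gt0 //.
  by rewrite hi lo.
by rewrite ltr_wpDr.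
Qed.
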